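(* Let $\bar c$ be an integer and let $c$ be the actual number of compromised sensors, with $c\le\bar c<s/2$. Let $\tilde f=f^{(s-\bar c)}$ be the voting rule with parameter $r=s-\bar c$. Then for every admissible attack $g$ (compromising $c$ sensors), $$\gamma(\tilde f,g)\ge (s-\bar c-c)\,I,$$ where $I=\min\{I_0,I_1\}$.
   Context: A binary state $\theta\in\{0,1\}$ is observed by $s$ sensors indexed by $\mathcal{S}=\{1,\dots,s\}$; at each time $k\in\mathbb{Z}^+$ sensor $i$ produces a real observation $x_i(k)$. Let $\mu,\nu$ be mutually absolutely continuous Borel probability measures on $\mathbb{R}$. Under $\mathbb{P}_\theta$ all $x_i(k)$ are independent, with law $\nu$ if $\theta=0$ and $\mu$ if $\theta=1$. Let $I_1=\int\log\frac{d\mu}{d\nu}\,d\mu$, $I_0=-\int\log\frac{d\mu}{d\nu}\,d\nu$, assumed $0<I_0,I_1<\infty$, and $I=\min\{I_0,I_1\}$. Attack model: an attacker compromises a fixed set $\mathcal{C}\subseteq\mathcal{S}$ with $|\mathcal{C}|=c$; the detector does not know $\mathcal{C}$ or $c$, only the upper bound $\bar c$. The fusion center receives $x'(k)=x(k)+x^a(k)$, where $x^a(k)\in\mathbb{R}^s$, the union over $k$ of the supports of $x^a(k)$ equals $\mathcal{C}$, and $x^a(k)=g(X_{\mathcal{C}}(k),X^a(k-1),\theta,k)$ is a measurable (possibly randomized) function of the true observations of the compromised sensors up to time $k$, the previously injected vectors, the true state $\theta$, and $k$. Such $g$ is an admissible attack; $\mathbb{P}^g_\theta,\mathbb{E}^g_\theta$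 denote probability and expectation of the manipulated observations. A detection strategy is $f=(f_1,f_2,\dots)$ with $f_k$ mapping $x'(1),\dots,x'(k)$ to $\{\text{continue},0,1\}$; stopping time $T$ is the first $k$ with $f_k\neq\text{continue}$, decision $f_T$. With $\alpha=\mathbb{P}^g_0[f_T=1]$, $\beta=\mathbb{P}^g_1[f_T=0]$, $D(T)=\max_\theta\mathbb{E}^g_\theta[T]$, the performance is $\gamma(f,g)=\lim_{\alpha=\beta\to0^+}\frac{\log(1/\alpha)}{D(T)}$, the limit taken along the family of tests for which $\alpha=\beta\to0$. Voting rule $f^{(r)}$ ($s/2<r\le s$): with $S_i(n)=\sum_{k=1}^n\log\frac{d\mu}{d\nu}(x'_i(k))$, thresholds $a=b>0$ (tending to $\infty$), $\tau^+_i(b)=\inf\{k:S_i(k)\ge b\}$, $\tau^-_i(a)=\inf\{k:S_i(k)\le -a\}$, and $\tau^\pm_{(j)}$ the $j$-th smallest of these over $i$; the rule stops at $\min\{\tau^-_{(r)}(a),\tau^+_{(r)}(b)\}$, deciding $0$ if $\tau^-_{(r)}(a)<\tau^+_{(r)}(b)$, $1$ if $\tau^+_{(r)}(b)<\tau^-_{(r)}(a)$, and $0$ or $1$ with probability $1/2$ each if equal. *)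

(* Defs.v *)
From HB Require Import structures.
From mathcomp Require Import all_boot all_order all_algebra.
From mathcomp Require Import all_classical all_reals all_analysis.

Set Implicit Arguments.
Unset Strict Implicit.
Unset Printing Implicit Defensive.

Import Order.TTheory GRing.Theory Num.Theory.
Import numFieldNormedType.Exports.
Local Open Scope classical_set_scope.
Local Open Scope ring_scope.

Section Defs.
Context {R : realType}.

Definition mutually_independent {d} {Omega : measurableType d}
  (P : probability Omega R) {I : eqType} (X : I -> Omega -> R) : Prop :=
  forall (J : seq I) (B : I -> set R), uniq J ->
    (forall j, measurable (B j)) ->
    P (\bigcap_(j in [set j | j \in J]) (X j @^-1` B j)) =
    (\prod_(j <- J) P (X j @^-1` B j))%E.

Definition first_time (p : nat -> Prop) : \bar R :=
  ereal_inf [set ((n%:R)%:E : \bar R) | n in [set n : nat | (1 <= n)%N /\ p n]].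

Definition order_stat {s : nat} (j : nat) (t : 'I_s -> \bar R) : \bar R :=
  nth +oo%E (sort <=%O [seq t i | i <- enum 'I_s]) j.-1.

Definition err_exponent (p : \bar R) : \bar R :=
  if p == 0%E then +oo%E else (- ln (fine p))%:E.

End Defs.

(* The sensor model.  Observations are indexed by k : nat, where x k i is the
   observation x_i(k+1) of sensor i at time k+1 (times are 1, 2, ...).       *)
Section Voting.
Context {R : realType} {d : measure_display} {Omega : measurableType d}
  {s : nat}.
Variables (ell : R -> R)                       (* ell = log (d mu / d nu) *)
  (x' : nat -> 'I_s -> Omega -> R)              (* manipulated observations *)
  (r : nat) (b : R).                            (* voting parameter, a = b *)

Definition llr_sum (i : 'I_s) (n : nat) (w : Omega) : R :=
  \sum_(k < n) ell (x' k i w).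

Definition tau_up (i : 'I_s) (w : Omega) : \bar R :=
  first_time (fun n => b <= llr_sum i n w).
Definition tau_dn (i : 'I_s) (w : Omega) : \bar R :=
  first_time (fun n => llr_sum i n w <= - b).

Definition tau_up_r (w : Omega) : \bar R := order_stat r (tau_up ^~ w).
Definition tau_dn_r (w : Omega) : \bar R := order_stat r (tau_dn ^~ w).

Definition vote_T (w : Omega) : \bar R := Order.min (tau_dn_r w) (tau_up_r w).

(* Probability that f^(r) decides 1 (resp. 0) under P, the tie being broken by
   an independent fair coin. *)
Definition prob_decide1 (P : probability Omega R) : \bar R :=
  (P [set w | tau_up_r w < tau_dn_r w] +
   2^-1%:E * P [set w | tau_up_r w = tau_dn_r w /\ tau_up_r w < +oo])%E.
Definition prob_decide0 (P : probability Omega R) : \bar R :=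
  (P [set w | tau_dn_r w < tau_up_r w] +
   2^-1%:E * P [set w | tau_up_r w = tau_dn_r w /\ tau_up_r w < +oo])%E.

End Voting.

(* Main.v *)
(** A wrong decision requires r sensors to cross the wrong threshold, hence at
    least r - |C| honest ones.  For an honest sensor, the exponential of the
    log-likelihood sum in the wrong direction is a nonnegative martingale of
    mean 1; by independence the product over any set J of honest sensors,
    each stopped at its own first passage of b, still has mean at most 1, so
    Markov's inequality bounds the error by 2^s exp (- b (r - |C|)), the factor
    2^s counting the choices of J.  In the right direction, finiteness of the
    exponential moment E exp (- ell) = 1 turns the positive drift into
    E exp (- lam ell) <= exp (- lam c) for every c < I and some lam > 0; summing
    the resulting Chernoff bounds, all honest sensors (at least r) have
    crossed b after b / c + O(1) steps on average.  Neither bound looks at the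
    compromised sensors, hence they hold whatever the attack does, and
    c -> I gives the exponent. *)
Require Import Defs.
From HB Require Import structures.
From mathcomp Require Import all_boot all_order all_algebra.
From mathcomp Require Import all_classical all_reals all_analysis.
From mathcomp Require Import measurable_realfun zify ring lra.
Set Implicit Arguments.
Unset Strict Implicit.
Unset Printing Implicit Defensive.

Import Order.TTheory GRing.Theory Num.Theory.
Import numFieldNormedType.Exports.
Local Open Scope classical_set_scope.
Local Open Scope ring_scope.

(** * Change of measure by a density *)

Section Density.
Local Open Scope ereal_scope.
Context {d} {T : measurableType d} {R : realType}.
Variables (m1 m2 : {measure set T -> \bar R}) (rho : T -> R).
Hypotheses (mrho : measurable_fun setT rho) (rho0 : forall x, (0 <= rho x)%R).
Hypothesis m1E : forall A, measurable A -> m1 A = \int[m2]_(x in A) (rho x)%:E.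

Import HBNNSimple.

Let integral_density_nnsfun (h : {nnsfun T >-> R}) :
  \int[m1]_x (h x)%:E = \int[m2]_x ((h x)%:E * (rho x)%:E).
Proof.
under eq_integral do rewrite fimfunE -fsumEFin//.
rewrite ge0_integral_fsum//; last 2 first.
  - by move=> r; exact/measurable_EFinP/measurableT_comp.
  - by move=> n x _; rewrite EFinM nnfun_muleindic_ge0.
under [RHS]eq_integral => x _.
  rewrite fimfunE -fsumEFin// ge0_mule_fsuml; last first.
    by move=> r; rewrite EFinM nnfun_muleindic_ge0.
  over.
rewrite ge0_integral_fsum//; last 2 first.
  - move=> r; apply: emeasurable_funM; last exact/measurable_EFinP.
    by apply/measurable_EFinP; do 2 apply/measurableT_comp => //.
  - move=> n x _; apply: mule_ge0; last by rewrite lee_fin.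
    by rewrite EFinM nnfun_muleindic_ge0.
apply: eq_fsbigr => r _.
rewrite integralZl_indic_nnsfun//= integral_indic//= setIT m1E//.
under [RHS]eq_integral do rewrite EFinM -muleA.
(* A negative [r] is not a value of [h], so its preimage is empty and both sides vanish; a
   nonnegative [r] may be pulled out of the integral. *)
have [r0|r0] := ltP r 0%R.
  rewrite preimage_nnfun0// integral_set0 mule0 integral0_eq// => x _.
  by rewrite indic0 mul0e mule0.
rewrite ge0_integralZl//; last 2 first.
  - by apply: emeasurable_funM; exact/measurable_EFinP.
  - by move=> x _; rewrite mule_ge0// lee_fin.
congr (_ * _); rewrite integral_mkcond; apply: eq_integral => x _.
by rewrite patchE indicE; case: (x \in _); rewrite (mul1e, mul0e).
Qed.

(** Monotone convergence, applied on both sides to the same increasing simple approximations of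
    [f]. *)
Lemma ge0_integral_density (f : T -> \bar R) :
  measurable_fun setT f -> (forall x, 0 <= f x) ->
  \int[m1]_x f x = \int[m2]_x (f x * (rho x)%:E).
Proof.
move=> mf f0; pose f_ := nnsfun_approx measurableT mf.
have f_f x : (f_ n x)%:E @[n --> \oo] --> f x.
  by apply: cvg_nnsfun_approx.
have f_nd x (m n : nat) : (m <= n)%N -> (f_ m x)%:E <= (f_ n x)%:E.
  by move=> mn; rewrite lee_fin; exact/lefP/nd_nnsfun_approx.
transitivity (lim (\int[m1]_x (f_ n x)%:E @[n --> \oo])).
  rewrite -monotone_convergence//=.
  - by apply: eq_integral => x _; apply/esym/cvg_lim.
  - by move=> n; exact/measurable_EFinP.
  - by move=> n ? _; rewrite lee_fin.
  - by move=> x _ m n mn; exact: f_nd.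
under eq_fun do rewrite integral_density_nnsfun.
rewrite -monotone_convergence//=.
- apply: eq_integral => x _; apply/cvg_lim => //.
  by apply: cvgeZr.
- by move=> n; apply: emeasurable_funM; exact/measurable_EFinP.
- by move=> n x _; rewrite mule_ge0// lee_fin.
- by move=> x _ m n mn; apply: lee_wpmul2r; [rewrite lee_fin|exact: f_nd].
Qed.
End Density.

(** * Order statistics *)

(** The entries below [y] form a prefix of a sorted list. *)
Lemma nth_sorted_lt {R : realType} (l : seq (\bar R)) (x0 y : \bar R) (k : nat) :
  sorted <=%O l -> (k < size l)%N ->
  (nth x0 l k < y)%O = (k < count (fun x => x < y)%O l)%N.
Proof.
elim: l k => // x l IH k /= xl kl.
have sl : sorted <=%O l by exact: path_sorted xl.
have [xy|yx] := ltP x y.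
  by case: k kl => [|k] kl //=; rewrite IH.
have lt0 : count (fun x => x < y)%O l = 0%N.
  apply/eqP; rewrite -leqn0 leqNgt -has_count; apply/hasPn => z zl.
  rewrite -leNgt (le_trans yx)//.
  by move: xl; rewrite path_sortedE; [case/andP=> /allP/(_ _ zl)|exact: le_trans].
rewrite lt0; case: k kl => [|k] kl /=; first by rewrite ltNge yx.
by rewrite IH// lt0.
Qed.

Section OrderStat.
Context {R : realType} {s : nat}.
Implicit Types (t : 'I_s -> \bar R) (y : \bar R).

(** Replaces sorting by counting, the form in which order statistics are handled from here on;
    [j <= s] keeps [nth] away from its default. *)
Lemma order_stat_lt (j : nat) t y : (0 < j <= s)%N ->
  (order_stat j t < y)%O = (j <= #|[set i | (t i < y)%O]%SET|)%N.
Proof.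
case: j => // j js; rewrite /order_stat nth_sorted_lt//=.
- rewrite count_sort count_map enumT cardE /enum_mem size_filter; congr (_ < _)%N.
  by apply: eq_count => i; rewrite /= -[RHS]/(i \in _) inE.
- exact/sort_sorted/le_total.
- by rewrite size_sort size_map size_enum_ord.
Qed.

(** At least [j] of the [t i] lie below [y] iff this holds throughout some index set of size at
    least [j], and there are finitely many such sets. *)
Lemma measurable_order_stat d (T : measurableType d) (j : nat)
    (t : 'I_s -> T -> \bar R) : (0 < j <= s)%N ->
  (forall i, measurable_fun setT (t i)) ->
  measurable_fun setT (fun w => order_stat j (t ^~ w)).
Proof.
move=> js mt.
apply: (measurability _ (ErealGenInftyO.measurableE R)) => // _ [_ [y ->] <-].
rewrite setTI (_ : _ @^-1` _ = \bigcup_(J in [set J : {set 'I_s} | (j <= #|J|)%N])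
    \bigcap_(i in [set i | i \in J]) [set w | (t i w < y%:E)%O]).
  apply: fin_bigcup_measurable => // J _; apply: fin_bigcap_measurable => // i _.
  by rewrite -[X in measurable X]setTI; exact: emeasurable_fun_infty_o.
apply/seteqP; split => w /=; rewrite in_itv/= order_stat_lt//.
  move=> h; exists [set i | (t i w < y%:E)%O]%SET => //= i /=.
  by rewrite inE.
move=> [J /= jJ tJ]; apply: leq_trans jJ _; apply: subset_leq_card.
by apply/fintype.subsetP => i iJ; rewrite inE; exact: tJ.
Qed.
End OrderStat.

(** * Independence *)

Section Independence.
Context {R : realType} {d : measure_display} {Omega : measurableType d}.
Variable P : probability Omega R.

(** The hypothesis on rectangles identifies the joint law of [Z] and [X] as a product measure, and
    Tonelli splits the integral. [T1] is arbitrary so that [Z] can be the identity into a coarser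
    sigma-algebra. *)
Lemma ge0_integral_mul_independent d1 d2 (T1 : measurableType d1)
    (T2 : measurableType d2) (Z : Omega -> T1) (X : Omega -> T2)
    (m2 : probability T2 R) (Y : T1 -> \bar R) (f : T2 -> \bar R) :
  measurable_fun setT Z -> measurable_fun setT X ->
  (forall A B, measurable A -> measurable B ->
     P (Z @^-1` A `&` X @^-1` B) = (P (Z @^-1` A) * m2 B)%E) ->
  measurable_fun setT Y -> (forall z, 0 <= Y z)%E ->
  measurable_fun setT f -> (forall x, 0 <= f x)%E ->
  (\int[P]_w (Y (Z w) * f (X w)) = \int[P]_w Y (Z w) * \int[m2]_x f x)%E.
Proof.
move=> mZ mX ZX mY Y0 mf f0.
pose Z' : {mfun Omega >-> T1} := mfun_Sub (mem_set mZ).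
have mZX : measurable_fun setT (fun w => (Z w, X w)) by exact/measurable_fun_pair.
pose h (zx : T1 * T2) := (Y zx.1 * f zx.2)%E.
have mh : measurable_fun setT h.
  by apply: emeasurable_funM; apply: measurableT_comp.
have h0 zx : (0 <= h zx)%E by exact: mule_ge0.
transitivity (\int[pushforward P (fun w => (Z w, X w))]_zx h zx)%E.
  by rewrite ge0_integral_pushforward.
transitivity (\int[distribution P Z' \x m2]_zx h zx)%E.
  apply: eq_measure_integral => A mA _; apply/esym.
  by apply: product_measure_unique => // B D mB mD; exact: ZX.
rewrite fubini_tonelli1//.
transitivity (\int[distribution P Z']_z (Y z * \int[m2]_x f x))%E.
  by apply: eq_integral => z _; rewrite /fubini_F /h/= ge0_integralZl.
rewrite ge0_integralZr//; last exact: integral_ge0.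
by rewrite ge0_integral_pushforward.
Qed.

Variables (I : eqType) (X : I -> Omega -> R).
Hypothesis mX : forall i, measurable_fun setT (X i).
Hypothesis indX : mutually_independent P X.

(* A pi-system generating the sigma-algebra of all [X q] with [q != p]. *)
Definition cylinders_off (p : I) : set (set Omega) :=
  [set A | exists (J : seq I) (B : I -> set R), [/\ p \notin J,
     (forall j, measurable (B j)) &
     A = \bigcap_(j in [set j | j \in J]) X j @^-1` B j]].

Let measurable_cylinder (J : seq I) (B : I -> set R) :
  (forall j, measurable (B j)) ->
  measurable (\bigcap_(j in [set j | j \in J]) X j @^-1` B j).
Proof.
move=> mB; apply: fin_bigcap_measurable; first exact: finite_seq.
by move=> j _; rewrite -[X in measurable X]setTI; exact: mX.
Qed.

Lemma cylinders_off_measurable p : cylinders_off p `<=` measurable.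
Proof. by move=> _ [J [B [_ mB ->]]]; exact: measurable_cylinder. Qed.

Lemma cylinders_off_setI p : setI_closed (cylinders_off p).
Proof.
move=> _ _ [J1 [B1 [p1 mB1 ->]]] [J2 [B2 [p2 mB2 ->]]].
pose B j := (if j \in J1 then B1 j else setT) `&` (if j \in J2 then B2 j else setT).
exists (J1 ++ J2), B; split.
- by rewrite mem_cat negb_or p1.
- by move=> j; apply: measurableI; case: ifP.
- apply/seteqP; split => w /=.
    by move=> [h1 h2] j /= _; split; case: ifP => // jJ; [exact: h1|exact: h2].
  move=> h; split => j /= jJ; have /= := h j; rewrite mem_cat jJ ?orbT.
    by case/(_ isT) => /=; rewrite jJ.
  by case/(_ isT) => /= _; rewrite jJ.
Qed.

(** As functions of [A], both sides are finite measures; they agree on the pi-system of cylinders,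
    hence on the sigma-algebra it generates. *)
Lemma cylinders_offP p (A : set Omega) (B : set R) :
  <<s cylinders_off p >> A -> measurable B ->
  P (A `&` X p @^-1` B) = (P A * P (X p @^-1` B))%E.
Proof.
move=> sA mB; have mXB : measurable (X p @^-1` B).
  by rewrite -[X in measurable X]setTI; exact: mX.
have c0 : (0 <= fine (P (X p @^-1` B)))%R by exact: fine_ge0.
transitivity (mscale (NngNum c0) P A); last first.
  by rewrite /mscale/= fineK ?fin_num_measure// muleC.
apply: (@g_sigma_algebra_measure_unique _ _ _ (cylinders_off p)
  (@cylinders_off_measurable p) (fun=> setT) _ _
  (mrestr P mXB) (mscale (NngNum c0) P) (@cylinders_off_setI p)) => //.
- move=> _; exists [::], (fun=> setT); split => //.
  by apply/esym; apply/seteqP; split => // w _ j.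
- by rewrite bigcup_const//; exists 0%N.
- move=> _ [J [D [pJ mD ->]]]; rewrite /= /mscale /mrestr /= ?fineK ?fin_num_measure//.
  have <- : [set j | j \in undup J] = [set j | j \in J].
    by apply/seteqP; split => j /=; rewrite mem_undup.
  (* The event on [p] joins the family without disturbing the others, since [p] is not in [J]. *)
  pose D' j := if j == p then B else D j.
  have mD' j : measurable (D' j) by rewrite /D'; case: ifP.
  have DE j : j \in undup J -> D' j = D j.
    by rewrite mem_undup /D'; case: eqP => // -> jJ; rewrite jJ in pJ.
  have := @indX (p :: undup J) D' _ mD'; rewrite /= mem_undup pJ undup_uniq.
  move=> /(_ isT); rewrite big_cons {2}/D' eqxx.
  under eq_big_seq => j jJ do rewrite DE//.
  rewrite -(@indX (undup J) D (undup_uniq J) mD) => <-; congr (P _).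
  apply/seteqP; split => w /=.
    move=> [h1 h2] j /=; rewrite inE => /orP[/eqP ->|jJ].
      by rewrite /D' eqxx.
    by rewrite DE//; exact: h1.
  move=> h; split => [j /= jJ|].
    by have := h j; rewrite /= inE jJ orbT DE//; exact.
  by have := h p; rewrite /= inE eqxx /D' eqxx; exact.
- by move=> _; rewrite /mrestr; exact: fin_num_fun_lty.
Qed.

Lemma measurable_cylinders_off p q : q != p ->
  measurable_fun setT (X q : g_sigma_algebraType (cylinders_off p) -> R).
Proof.
move=> qp _ B mB; rewrite setTI; apply: sub_sigma_algebra.
exists [:: q], (fun=> B); split => //; first by rewrite inE eq_sym.
by apply/seteqP; split => w /= => [h j /=|/(_ q)/=]; rewrite inE;
  [move/eqP->|rewrite eqxx; exact].
Qed.

(** Here [Z] is the identity of [Omega], read into the sigma-algebra that ignores [X p]. *)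
Lemma ge0_integral_mul_off p (pi : probability R R) (Y : Omega -> \bar R)
    (f : R -> \bar R) :
  (forall B, measurable B -> P (X p @^-1` B) = pi B) ->
  measurable_fun setT (Y : g_sigma_algebraType (cylinders_off p) -> \bar R) ->
  (forall w, 0 <= Y w)%E -> measurable_fun setT f -> (forall x, 0 <= f x)%E ->
  (\int[P]_w (Y w * f (X p w)) = \int[P]_w Y w * \int[pi]_x f x)%E.
Proof.
move=> lawX mY Y0 mf f0.
apply: (@ge0_integral_mul_independent _ _
  (g_sigma_algebraType (cylinders_off p)) _ id) => //.
- move=> _ A mA; rewrite setTI preimage_id.
  exact: (smallest_sub (@sigma_algebra_measurable _ Omega)
    (@cylinders_off_measurable p)).
- by move=> A B mA mB; rewrite preimage_id cylinders_offP// lawX.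
Qed.

End Independence.

(** * First passages and exponential bounds *)

Section Crossing.
Context {R : realType}.
Implicit Types (u : nat -> R) (b : R).

(** The index [m.+1] excludes the empty sum, in accordance with [1 <= n] in [first_time]. *)
Definition crossed u b n : bool := [exists m : 'I_n, b <= \sum_(k < m.+1) u k].

(* The partial sum frozen at the first passage above [b]. *)
Definition stopped_sum u b n : R :=
  \sum_(k < n) (if crossed u b k then 0 else u k).

Lemma crossed_mono u b m n : (m <= n)%N -> crossed u b m -> crossed u b n.
Proof.
by move=> mn /existsP[k hk]; apply/existsP; exists (widen_ord mn k).
Qed.

Lemma crossedS u b n :
  crossed u b n.+1 = crossed u b n || (b <= \sum_(k < n.+1) u k).
Proof.
apply/idP/orP => [/existsP[m hm]|[|h]].
- have := ltn_ord m; rewrite ltnS leq_eqVlt => /orP[/eqP mn|mn].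
    by right; rewrite -mn.
  by left; apply/existsP; exists (Ordinal mn).
- exact: crossed_mono.
- by apply/existsP; exists ord_max.
Qed.

Lemma stopped_sumE u b n : ~~ crossed u b n ->
  stopped_sum u b n = \sum_(k < n) u k.
Proof.
move=> nc; apply: eq_bigr => k _; case: ifPn => // ck.
by rewrite (crossed_mono _ ck) ?(ltnW (ltn_ord k)) in nc.
Qed.

(** The increments vanish after the passage, so the value reached there, at least [b], persists. *)
Lemma crossed_stopped_sum u b n : crossed u b n -> b <= stopped_sum u b n.
Proof.
elim: n => [/existsP[[]]//|n IH]; rewrite /stopped_sum big_ord_recr/=.
have [cn _|nc] := boolP (crossed u b n); first by rewrite addr0; exact: IH.
rewrite crossedS (negbTE nc)/= big_ord_recr/= => h.
by rewrite -/(stopped_sum u b n) stopped_sumE.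
Qed.

Context {d} {T : measurableType d}.
Implicit Type v : nat -> T -> R.

Lemma measurable_psum v n : (forall k, (k < n)%N -> measurable_fun setT (v k)) ->
  measurable_fun setT (fun w => \sum_(k < n) v k w).
Proof. by move=> mv; apply: measurable_sum => k; exact: mv. Qed.

Lemma measurable_crossed v b n :
  (forall k, (k < n)%N -> measurable_fun setT (v k)) ->
  measurable_fun setT (fun w => crossed (v ^~ w) b n).
Proof.
move=> mv; apply: (measurable_fun_bool true); rewrite setTI.
rewrite (_ : _ @^-1` _ =
    \bigcup_(m in [set: 'I_n]) [set w | b <= \sum_(k < m.+1) v k w]).
  apply: fin_bigcup_measurable; first exact: finite_finset.
  move=> m _; rewrite -[X in measurable X]setTI.
  apply: measurable_fun_le => //; apply: measurable_psum => k km.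
  by apply: mv; exact: leq_trans km (ltn_ord m).
by apply/seteqP; split => w /= => [/existsP[m hm]|[m _ hm]];
  [exists m|apply/existsP; exists m].
Qed.

Lemma measurable_stopped_sum v b n :
  (forall k, (k < n)%N -> measurable_fun setT (v k)) ->
  measurable_fun setT (fun w => stopped_sum (v ^~ w) b n).
Proof.
move=> mv; apply: measurable_sum => k; apply: measurable_fun_ifT => //=.
  by apply: measurable_crossed => j jk; apply: mv; exact: ltn_trans jk (ltn_ord k).
exact: mv.
Qed.

End Crossing.

Lemma measurable_fun_expR {d} {T : measurableType d} {R : realType} (D : set T)
  (f : T -> R) : measurable_fun D f -> measurable_fun D (fun x => expR (f x)).
Proof. exact: measurableT_comp. Qed.

(** Asking measurability of the listed indices only matters below: the other sensors are measurable
    off sensor [i] because [i] is not in the list. *)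
Lemma measurable_sum_seq {d} {T : measurableType d} {R : realType} (D : set T)
    (I : eqType) (s : seq I) (h : I -> T -> R) :
  (forall i, i \in s -> measurable_fun D (h i)) ->
  measurable_fun D (fun x => \sum_(i <- s) h i x).
Proof.
move=> mh; rewrite (_ : (fun _ => _) =
    fun x => \sum_(i <- s) (if i \in s then h i x else 0)).
  apply: measurable_sum => i; case: (boolP (i \in s)) => [/mh//|_].
  exact: measurable_cst.
by apply/funext => x; apply: eq_big_seq => i ->.
Qed.

(** * Exponential moments of free and of stopped sums *)

Section ExponentialBounds.
Context {R : realType} {d : measure_display} {Omega : measurableType d} {s : nat}.
Variables (P : probability Omega R) (x : nat -> 'I_s -> Omega -> R) (U : Omega -> R).
Let X (o : option (nat * 'I_s)) :=
  match o with None => U | Some p => x p.1 p.2 end.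
Hypothesis mx : forall k i, measurable_fun setT (x k i).
Hypothesis mU : measurable_fun setT U.
Hypothesis indX : mutually_independent P X.
Variables (pi : probability R R) (g : R -> R).
Hypothesis lawX : forall k i B, measurable B -> P (x k i @^-1` B) = pi B.
Hypothesis mg : measurable_fun setT g.

Let mX o : measurable_fun setT (X o).
Proof. by case: o => [[k i]|]/=. Qed.

(** Being a type on the carrier [Omega], it lets independence from [x k i] be expressed by a type
    annotation. *)
Let off k i := g_sigma_algebraType (cylinders_off X (Some (k, i))).

Let moff k i k' i' : (k', i') != (k, i) ->
  measurable_fun setT ((fun w => g (x k' i' w)) : off k i -> R).
Proof.
move=> ki; apply: measurableT_comp => //.
by apply: (@measurable_cylinders_off _ _ _ _ X (Some (k, i)) (Some (k', i'))).
Qed.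

Lemma integral_mul_obs k i (W : Omega -> R) (f : R -> R) :
  measurable_fun setT (W : off k i -> R) -> (forall w, 0 <= W w) ->
  measurable_fun setT f -> (forall y, 0 <= f y) ->
  (\int[P]_w (W w * f (x k i w))%:E = \int[P]_w (W w)%:E * \int[pi]_y (f y)%:E)%E.
Proof.
move=> mW W0 mf f0.
under eq_integral do rewrite EFinM.
apply: (@ge0_integral_mul_off _ _ _ P _ X mX indX (Some (k, i)) pi
  (EFin \o W) (EFin \o f)) => //.
- exact: lawX.
- exact/measurable_EFinP.
- exact/measurable_EFinP.
Qed.

(** The newest observation is independent of the earlier ones and contributes a factor at most
    [rho]. *)
Lemma integral_expR_psum (rho : R) (lam : R) i n : 0 <= rho ->
  (\int[pi]_y (expR (lam * g y))%:E <= rho%:E)%E ->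
  (\int[P]_w (expR (lam * \sum_(k < n) g (x k i w)))%:E <= (rho ^+ n)%:E)%E.
Proof.
move=> rho0 hrho; elim: n => [|n IH].
  under eq_integral do rewrite big_ord0 mulr0 expR0.
  by rewrite integral_cst//= probability_setT mule1 expr0.
under eq_integral do rewrite big_ord_recr/= mulrDr expRD.
rewrite (@integral_mul_obs n i _ (fun y => expR (lam * g y))).
- rewrite exprSr EFinM; apply: lee_pmul => //.
  + by apply: integral_ge0 => w _; rewrite lee_fin expR_ge0.
  + by apply: integral_ge0 => w _; rewrite lee_fin expR_ge0.
- apply: measurable_fun_expR; apply: measurable_funM => //.
  apply: (@measurable_psum _ _ (off n i) (fun k w => g (x k i w))) => k kn; apply: moff.
  by rewrite xpair_eqE negb_and (ltn_eqF kn).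
- by move=> w; exact: expR_ge0.
- by apply: measurable_fun_expR; exact: measurable_funM.
- by move=> y; exact: expR_ge0.
Qed.

Hypothesis expg : (\int[pi]_y (expR (g y))%:E <= 1)%E.
Variable b : R.
Let Z n (j : 'I_s) w := stopped_sum (fun k => g (x k j w)) b n.

(** Induction on the sensors, then on the time of the newest sensor [i] alone, the others already
    standing at [N]. Its next increment is independent of its own past and of the other sensors at
    all times, so a step not yet stopped multiplies by a factor of mean at most 1. *)
Lemma integral_expR_stopped_sum (J : seq 'I_s) N : uniq J ->
  (\int[P]_w (expR (\sum_(j <- J) Z N j w))%:E <= 1)%E.
Proof.
elim: J => [_|i J IH /= /andP[iJ uJ]].
  under eq_integral do rewrite big_nil expR0.
  by rewrite integral_cst//= probability_setT mule1.
suff H n : (\int[P]_w (expR (Z n i w + \sum_(j <- J) Z N j w))%:E <= 1)%E.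
  by under eq_integral do rewrite big_cons; exact: H.
elim: n => [|n IHn].
  under eq_integral do rewrite /Z /stopped_sum big_ord0 add0r.
  exact: IH.
pose W w := expR (Z n i w + \sum_(j <- J) Z N j w).
pose A w := crossed (fun k => g (x k i w)) b n.
have mW : measurable_fun setT (W : off n i -> R).
  apply: (@measurable_fun_expR _ (off n i)); apply: measurable_funD.
    apply: (@measurable_stopped_sum _ _ (off n i) (fun k w => g (x k i w))) => k kn.
    apply: moff.
    by rewrite xpair_eqE negb_and (ltn_eqF kn).
  apply: measurable_sum_seq => j jJ.
  apply: (@measurable_stopped_sum _ _ (off n i) (fun k w => g (x k j w))) => k _.
  apply: moff; rewrite xpair_eqE negb_and; apply/orP; right.
  by apply: contraNneq iJ => <-.
have mA : measurable_fun setT (A : off n i -> bool).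
  apply: (@measurable_crossed _ _ (off n i) (fun k w => g (x k i w))) => k kn.
  apply: moff.
  by rewrite xpair_eqE negb_and (ltn_eqF kn).
(* [W1] is already stopped; only [W2] is multiplied by a fresh factor. *)
pose W1 w := if A w then W w else 0.
pose W2 w := if A w then 0 else W w.
have mW1 : measurable_fun setT (W1 : off n i -> R) by exact: measurable_fun_ifT.
have mW2 : measurable_fun setT (W2 : off n i -> R) by exact: measurable_fun_ifT.
have suboff (f : Omega -> R) : measurable_fun setT (f : off n i -> R) ->
  measurable_fun setT f.
  move=> mf _ B mB.
  have := mf measurableT B mB; apply: smallest_sub => //.
    exact: sigma_algebra_measurable.
  exact: cylinders_off_measurable mX _.
have W0 w : 0 <= W w by exact: expR_ge0.
have W10 w : 0 <= W1 w by rewrite /W1; case: ifP.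
have W20 w : 0 <= W2 w by rewrite /W2; case: ifP.
apply: le_trans IHn.
have -> : (\int[P]_w (expR (Z n.+1 i w + \sum_(j <- J) Z N j w))%:E =
    \int[P]_w ((W1 w)%:E + (W2 w * expR (g (x n i w)))%:E))%E.
  apply: eq_integral => w _; rewrite -EFinD; congr EFin.
  rewrite /W1 /W2 /W /Z /stopped_sum big_ord_recr/= -/(A w).
  case: ifPn => _; first by rewrite addr0 mul0r addr0.
  by rewrite add0r -expRD addrAC.
rewrite ge0_integralD//=; last 4 first.
- by move=> w _; rewrite lee_fin.
- by apply/measurable_EFinP; exact: suboff.
- by move=> w _; rewrite lee_fin mulr_ge0// expR_ge0.
- apply/measurable_EFinP; apply: measurable_funM; first exact: suboff.
  apply: (@measurable_fun_expR _ Omega _ setT (fun w => g (x n i w))).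
  exact: measurableT_comp.
rewrite (@integral_mul_obs n i _ (fun y => expR (g y))); last 4 first.
- exact: mW2.
- exact: W20.
- exact: measurable_fun_expR.
- by move=> y; exact: expR_ge0.
have -> : (\int[P]_w (W w)%:E = \int[P]_w ((W1 w)%:E + (W2 w)%:E))%E.
  apply: eq_integral => w _; rewrite -EFinD; congr EFin.
  by rewrite /W1 /W2; case: ifP; rewrite (addr0, add0r).
rewrite ge0_integralD//=; last 4 first.
- by move=> w _; rewrite lee_fin.
- by apply/measurable_EFinP; exact: suboff.
- by move=> w _; rewrite lee_fin.
- by apply/measurable_EFinP; exact: suboff.
apply: leeD => //; rewrite -[leRHS]mule1; apply: lee_wpmul2l => //.
by apply: integral_ge0 => w _; rewrite lee_fin.
Qed.

(** Markov's inequality: on this event each stopped sum is at least [b]. *)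
Lemma prob_all_crossed (J : seq 'I_s) N : uniq J ->
  (P [set w | forall j, j \in J -> crossed (fun k => g (x k j w)) b N]
   <= (expR (- (b *+ size J)))%:E)%E.
Proof.
move=> uJ; set A := [set w | _].
have mZ j : measurable_fun setT (fun w => Z N j w).
  apply: (@measurable_stopped_sum _ _ _ (fun k w => g (x k j w))) => k _.
  exact: measurableT_comp.
have mA : measurable A.
  rewrite (_ : A = \bigcap_(j in [set j | j \in J])
      [set w | crossed (fun k => g (x k j w)) b N])//.
  apply: fin_bigcap_measurable; first exact: finite_seq.
  move=> j _; rewrite -[X in measurable X]setTI.
  apply: (@measurable_crossed _ _ _ (fun k w => g (x k j w))) => // k _.
  exact: measurableT_comp.
have : (\int[P]_w ((expR (b *+ size J))%:E * (\1_A w)%:E) <= 1)%E.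
  apply: le_trans (integral_expR_stopped_sum N uJ); apply: ge0_le_integral => //.
  - by apply: emeasurable_funM => //; apply/measurable_EFinP; exact: measurable_indic.
  - apply/measurable_EFinP; apply: measurable_fun_expR.
    by apply: measurable_sum => j; exact: mZ.
  - move=> w _; rewrite -EFinM lee_fin indicE; have [wA|_] := boolP (w \in A); last first.
      by rewrite mulr0 expR_ge0.
    move: wA; rewrite inE => wA; rewrite mulr1 ler_expR.
    have -> : b *+ size J = \sum_(j <- J) b.
      by rewrite big_const_seq count_predT iter_addr_0.
    rewrite !big_seq; apply: ler_sum => j /wA; exact: crossed_stopped_sum.
rewrite ge0_integralZl//; last by apply/measurable_EFinP; exact: measurable_indic.
rewrite integral_indic//= setIT => h.
by rewrite expRN -[leRHS]mule1 lee_pdivlMl ?expR_gt0.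
Qed.
End ExponentialBounds.

(** * A negative mean yields an exponential moment below 1 *)

Section SmallExponent.
Context {R : realType}.

Lemma expR_quotient_ge (x : R) n : x <= n.+1%:R * (expR (x / n.+1%:R) - 1).
Proof.
rewrite mulrC -ler_pdivrMr ?ltr0n// lerBrDl; exact: expR_ge1Dx.
Qed.

(** Bernoulli's inequality for the power [n.+1] of [expR (x / n.+1%:R)]. *)
Lemma expR_quotient_le (x : R) n : n.+1%:R * (expR (x / n.+1%:R) - 1) <= expR x.
Proof.
have -> : expR x = expR (x / n.+1%:R) ^+ n.+1.
  by rewrite -expRM_natl mulrC divfK// pnatr_eq0.
have := expR_ge0 (x / n.+1%:R); move: (expR _) => t t0.
have bern m : 1 + m%:R * (t - 1) <= t ^+ m.
  elim: m => [|m IH]; first by rewrite mul0r addr0 expr0.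
  (* This square is exactly the excess of [t * (1 + m%:R * (t - 1))] over the bound for [m.+1]. *)
  rewrite exprS -natr1; have : 0 <= (t - 1) ^+ 2 * m%:R by rewrite mulr_ge0 ?sqr_ge0.
  have := ler_wpM2l t0 IH; nra.
by have := bern n.+1; lra.
Qed.

(** With [y = x / n.+1%:R], the inequality [1 - y <= expR (- y)] gives the upper bound [x / (1 - y)]
    as soon as [y < 1], and the squeeze applies. *)
Lemma cvg_expR_quotient (x : R) :
  n.+1%:R * (expR (x / n.+1%:R) - 1) @[n --> \oo] --> x.
Proof.
have h : (fun n : nat => x / n.+1%:R) @ \oo --> (0 : R).
  rewrite -[X in _ --> X](mulr0 x); apply: cvgM; first exact: cvg_cst.
  exact: cvg_harmonic.
have lim1 : (fun n : nat => x / (1 - x / n.+1%:R)) @ \oo --> x.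
  rewrite -[X in _ --> X]divr1 -[X in _ / X]subr0.
  apply: cvgM; first exact: cvg_cst.
  apply: cvgV; first by rewrite subr0 oner_neq0.
  by apply: cvgB => //; exact: cvg_cst.
apply: squeeze_cvgr (cvg_cst x) lim1.
near=> n; rewrite expR_quotient_ge/=.
have : x / n.+1%:R < 1 by near: n; exact: (cvgr_lt 0).
rewrite -subr_gt0 => y1; rewrite ler_pdivlMr//.
have : (expR (x / n.+1%:R)) * (1 - x / n.+1%:R) <= 1.
  rewrite -[leRHS](expRxMexpNx_1 (x / n.+1%:R)) ler_wpM2l ?expR_ge0//.
  exact: expR_ge1Dx.
have n0 : n.+1%:R != 0 :> R by rewrite pnatr_eq0.
move: y1; set y := x / _ => y1 ey.
have -> : x = n.+1%:R * y by rewrite /y mulrC divfK.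
rewrite -mulrA ler_wpM2l//; nra.
Unshelve. all: by end_near. Qed.

(* The difference quotients of [lam |-> expR (lam * g)] at 0 lie between [g] and
   [expR g], so dominated convergence identifies the derivative of the moment
   generating function at 0 with the mean of [g]. *)
Lemma exponential_moment (pi : probability R R) (g : R -> R) (c : R) :
  pi.-integrable setT (EFin \o g) ->
  (\int[pi]_y (expR (g y))%:E <= 1)%E ->
  (\int[pi]_y (g y)%:E < (- c)%:E)%E ->
  exists2 lam : R, 0 < lam &
    (\int[pi]_y (expR (lam * g y))%:E <= (expR (- (lam * c)))%:E)%E.
Proof.
move=> ig ieg gc.
have mg : measurable_fun setT g by apply/measurable_EFinP; exact: measurable_int ig.
pose f n y : R := n.+1%:R * (expR (g y / n.+1%:R) - 1).
have mf n : measurable_fun setT (f n).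
  apply: measurable_funM => //; apply: measurable_funB => //.
  by apply: measurableT_comp => //; apply: measurable_funM.
have iexp : pi.-integrable setT (EFin \o (fun y => expR (g y))).
  apply/integrableP; split.
    by apply/measurable_EFinP; apply: measurableT_comp.
  under eq_integral do rewrite gee0_abs ?lee_fin ?expR_ge0//.
  by apply: le_lt_trans ieg _; rewrite ltry.
have idom : pi.-integrable setT (fun y => `|(g y)%:E| + (expR (g y))%:E)%E.
  by apply: integrableD => //; exact: integrable_abse.
have fdom n y : (`|(f n y)%:E| <= `|(g y)%:E| + (expR (g y))%:E)%E.
  have h1 := expR_quotient_ge (g y) n; have h2 := expR_quotient_le (g y) n.
  rewrite -EFinD lee_fin ler_norml; have := expR_ge0 (g y).
  have := ler_norm (g y); have := ler_norm (- g y); rewrite normrN /f => *.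
  by apply/andP; split; lra.
have fg : (\int[pi]_y (f n y)%:E)%E @[n --> \oo] --> (\int[pi]_y (g y)%:E)%E.
  have mfE n : measurable_fun setT (EFin \o f n) by exact/measurable_EFinP.
  have mgE : measurable_fun setT (EFin \o g) by exact/measurable_EFinP.
  have cvgf : {ae pi, forall y, setT y ->
      (fun n => (EFin \o f n) y) @ \oo --> (EFin \o g) y}.
    by apply: aeW => y _; apply: cvg_EFin; [exact: nearW|exact: cvg_expR_quotient].
  have domf : {ae pi, forall y n, setT y ->
      (`|(EFin \o f n) y| <= `|(g y)%:E| + (expR (g y))%:E)%E}.
    by apply: aeW => y n _; exact: fdom.
  by have [] := dominated_convergence measurableT mfE mgE cvgf idom domf.
have : \forall n \near \oo, (\int[pi]_y (f n y)%:E < (- c)%:E)%E.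
  exact: fg (open_ereal_lt' gc).
case=> N _ /(_ N (leqnn N)) /= hN.
have ifN : pi.-integrable setT (EFin \o f N).
  apply: le_integrable idom => //; first exact/measurable_EFinP.
  by move=> y _; rewrite [leRHS]gee0_abs ?adde_ge0 ?lee_fin ?expR_ge0//; exact: fdom.
(* For this [lam], [expR (lam * g y)] equals [1 + lam * f N y], whose mean is at most [1 - lam * c],
   hence at most [expR (- (lam * c))]. *)
exists (N.+1%:R^-1); first by rewrite invr_gt0.
have -> : (\int[pi]_y (expR (N.+1%:R^-1 * g y))%:E =
   \int[pi]_y (1 + (N.+1%:R^-1)%:E * (f N y)%:E))%E.
  apply: eq_integral => y _; rewrite -EFinM -EFinD /f mulKf ?pnatr_eq0//.
  by rewrite addrC subrK mulrC.
rewrite integralD//=; last 2 first.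
- by apply: (finite_measure_integrable_cst pi 1).
- exact: integrableZl.
rewrite integral_cst//= probability_setT mule1 integralZl//.
apply: (@le_trans _ _ (1 + (N.+1%:R^-1)%:E * (- c)%:E)%E).
  by apply: leeD => //; rewrite lee_wpmul2l// ?lee_fin ?invr_ge0// ltW.
by rewrite -EFinM -EFinD lee_fin mulrN; exact: expR_ge1Dx.
Qed.
End SmallExponent.

(** * Error probability and stopping time of the voting rule *)

Section FirstTime.
Context {R : realType}.
Implicit Types (p : nat -> Prop) (y : \bar R).

(** Covers the absence of any passage, where the infimum is [+oo]; with [y = +oo] it extracts a
    passage from finiteness. *)
Lemma first_time_lt p y : (first_time p < y)%E <->
  exists n, [/\ (1 <= n)%N, p n & (n%:R%:E < y)%E].
Proof.
split=> [/ereal_inf_lt[_ [n [n1 pn] <-] ny]|[n [n1 pn ny]]]; first by exists n.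
by apply: le_lt_trans ny; apply: ereal_inf_lbound; exists n.
Qed.

Lemma first_time_le p n : (1 <= n)%N -> p n -> (first_time p <= n%:R%:E :> \bar R)%E.
Proof. by move=> n1 pn; apply: ereal_inf_lbound; exists n. Qed.

Lemma first_time_ge1 p : (1 <= first_time p :> \bar R)%E.
Proof. by apply: le_ereal_inf_tmp => _ [n [n1 _] <-]; rewrite lee_fin ler1n. Qed.

Lemma order_stat_ge {s : nat} (j : nat) (t : 'I_s -> \bar R) y :
  (0 < j <= s)%N -> (forall i, (y <= t i)%E) -> (y <= order_stat j t)%E.
Proof.
move=> js yt; rewrite leNgt order_stat_lt// -ltnNge.
rewrite (_ : [set i | _]%SET = finset.set0) ?cards0; first by case/andP: js.
by apply/setP => i; rewrite !inE ltNge yt.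
Qed.

Lemma order_stat_le {s : nat} (j : nat) (t : 'I_s -> \bar R) y (A : {set 'I_s}) :
  (0 < j <= s)%N -> (j <= #|A|)%N -> (forall i, i \in A -> (t i <= y)%E) ->
  (order_stat j t <= y)%E.
Proof.
move=> js jA tA; rewrite leNgt; apply/negP => yz.
have := order_stat_lt t (order_stat j t) js; rewrite ltxx => /esym/negbT/negP; apply.
apply: leq_trans jA _; apply: subset_leq_card; apply/fintype.subsetP => i iA.
by rewrite inE; apply: le_lt_trans yz; exact: tA.
Qed.

End FirstTime.

(** * Measurability of the voting times *)

Section VoteMeasurable.
Context {R : realType} {d : measure_display} {Omega : measurableType d} {s : nat}.
Variables (h : R -> R) (y : nat -> 'I_s -> Omega -> R) (r : nat) (b : R).
Hypotheses (mh : measurable_fun setT h) (my : forall k i, measurable_fun setT (y k i)).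

Lemma measurable_tau_up i : measurable_fun setT (tau_up h y b i).
Proof.
apply: (measurability _ (ErealGenInftyO.measurableE R)) => // _ [_ [z ->] <-].
rewrite setTI (_ : _ @^-1` _ =
    \bigcup_(n in [set n | (1 <= n)%N /\ (n%:R%:E < z%:E)%E])
       [set w | b <= llr_sum h y i n w]).
  apply: bigcup_measurable => n _; rewrite -[X in measurable X]setTI.
  apply: measurable_fun_le => //; apply: measurable_sum => k.
  exact: measurableT_comp.
apply/seteqP; split => w /=; rewrite in_itv/=.
  by move=> /first_time_lt[n [n1 bn nz]]; exists n.
by move=> [n [n1 nz] bn]; apply/first_time_lt; exists n.
Qed.

Hypothesis rs : (0 < r <= s)%N.

Lemma measurable_tau_up_r : measurable_fun setT (tau_up_r h y r b).
Proof. by apply: measurable_order_stat => // i; exact: measurable_tau_up. Qed.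

Lemma tau_up_r_ge1 w : (1 <= tau_up_r h y r b w)%E.
Proof. by apply: order_stat_ge => // i; exact: first_time_ge1. Qed.

End VoteMeasurable.

Lemma measure_bigcup_seq_le {d} {T : measurableType d} {R : realType}
    (m : {measure set T -> \bar R}) (I : eqType) (l : seq I) (F : I -> set T) :
  (forall i, measurable (F i)) ->
  (m (\bigcup_(i in [set i | i \in l]) F i) <= \sum_(i <- l) m (F i))%E.
Proof.
move=> mF; elim: l => [|i l IH].
  by rewrite big_nil (_ : \bigcup_(_ in _) _ = set0) ?measure0// -subset0 => x [].
rewrite big_cons (_ : \bigcup_(_ in _) _ = F i `|` \bigcup_(j in [set j | j \in l]) F j).
  apply: le_trans (measureU2 _ _ _) _ => //; last by rewrite leeD2l.
  by apply: fin_bigcup_measurable => //; exact: finite_seq.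
apply/seteqP; split => [t [j /=]|t [Fi|[j /= jl Fj]]].
- by rewrite inE => /orP[/eqP ->|jl] Fj; [left|right; exists j].
- by exists i => //=; rewrite mem_head.
- by exists j => //=; rewrite inE jl orbT.
Qed.

(** * Error and delay bounds for one direction, uniform in the attack *)

Section OneSidedBounds.
Context {R : realType} {d : measure_display} {Omega : measurableType d} {s : nat}.
Variables (P : probability Omega R) (x x' : nat -> 'I_s -> Omega -> R) (U : Omega -> R).
Hypothesis mx : forall k i, measurable_fun setT (x k i).
Hypothesis mx' : forall k i, measurable_fun setT (x' k i).
Hypothesis mU : measurable_fun setT U.
Hypothesis indX : mutually_independent P
  (fun o : option (nat * 'I_s) =>
     match o with None => U | Some p => x p.1 p.2 end).
Variables (pi : probability R R) (g : R -> R).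
Hypothesis lawX : forall k i B, measurable B -> P (x k i @^-1` B) = pi B.
Hypothesis mg : measurable_fun setT g.
Variable C : {set 'I_s}.
Hypothesis honest : forall k i w, i \notin C -> x' k i w = x k i w.
Variable r : nat.
Hypothesis rs : (0 < r <= s)%N.

Section WrongDecision.
Hypothesis expg : (\int[pi]_y (expR (g y))%:E <= 1)%E.
Variable b : R.
Hypothesis b0 : 0 <= b.

Let A (J : {set 'I_s}) N :=
  [set w | forall j, j \in enum J -> crossed (fun k => g (x k j w)) b N].

Let mA J N : measurable (A J N).
Proof.
rewrite (_ : A J N = \bigcap_(j in [set j | j \in enum J])
    [set w | crossed (fun k => g (x k j w)) b N])//.
apply: fin_bigcap_measurable; first exact: finite_seq.
move=> j _; rewrite -[X in measurable X]setTI.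
apply: (@measurable_crossed _ _ _ (fun k w => g (x k j w))) => // k _.
exact: measurableT_comp.
Qed.

Let mAU J : measurable (\bigcup_N A J N).
Proof. exact: bigcup_measurable. Qed.

(** The bound at a finite horizon is uniform in [N], and [A J N] increases with [N]. *)
Let prob_AU J : (P (\bigcup_N A J N) <= (expR (- (b *+ #|J|)))%:E)%E.
Proof.
have nd : nondecreasing_seq (A J).
  move=> m n mn; apply/subsetPset => w Aw j jJ.
  exact: crossed_mono mn (Aw j jJ).
have cv := nondecreasing_cvg_mu (mu := P) (mA J) (mAU J) nd.
rewrite -(cvg_lim _ cv)//; apply: lime_le; first exact: cvgP cv.
apply: nearW => N /=; rewrite cardE.
by apply: (prob_all_crossed mx mU indX lawX mg expg); exact: enum_uniq.
Qed.

Lemma prob_tau_up_r_lty :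
  (P [set w | tau_up_r g x' r b w < +oo] <=
   ((2 ^ s)%:R * expR (- (b *+ (r - #|C|))))%:E)%E.
Proof.
(* These sets may meet [C]: [A] concerns the true observations, so [prob_AU] bounds each of them,
   and there are at most [2 ^ s]. *)
pose l := [seq J : {set 'I_s} <- enum {set 'I_s} | (r - #|C| <= #|J|)%N].
have sub : [set w | tau_up_r g x' r b w < +oo]%E `<=`
    \bigcup_(J in [set J | J \in l]) \bigcup_N A J N.
  move=> w /=; rewrite order_stat_lt// => rI.
  set I := [set i | _]%SET in rI.
  pose J := I :\: C.
  have hJ j : j \in J -> exists N, crossed (fun k => g (x k j w)) b N.
    rewrite !inE => /andP[jC /first_time_lt[[|n] [n1 bn _]]] //.
    exists n.+1; apply/existsP; exists ord_max => /=.
    rewrite (le_trans bn)// /llr_sum le_eqVlt; apply/orP; left; apply/eqP.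
    by apply: eq_bigr => k _; rewrite honest.
  exists J => /=.
    rewrite mem_filter mem_enum andbT cardsD.
    by apply: leq_sub => //; apply: subset_leq_card; exact: finset.subsetIr.
  (* The largest of the horizons chosen for the individual sensors serves them all, by monotonicity;
     the default 0 never occurs on [J]. *)
  have [N hN] : exists N, forall j, j \in J -> crossed (fun k => g (x k j w)) b N.
    pose f j := if pselect (exists N, crossed (fun k => g (x k j w)) b N)
                is left e then projT1 (cid e) else 0%N.
    exists (\max_(j in J) f j) => j jJ.
    apply: (crossed_mono (m := f j)); first exact: leq_bigmax_cond.
    by rewrite /f; case: pselect => [e|/(_ (hJ j jJ))//]; case: cid.
  by exists N => // j; rewrite mem_enum; exact: hN.
apply: (@le_trans _ _ (P (\bigcup_(J in [set J | J \in l]) \bigcup_N A J N))).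
  apply: le_measure; rewrite ?inE//.
  - rewrite -[X in measurable X]setTI; apply: emeasurable_fun_infty_o => //.
    exact: measurable_tau_up_r.
  - by apply: fin_bigcup_measurable => //; exact: finite_seq.
apply: le_trans (measure_bigcup_seq_le _ _ _) _ => //.
apply: (@le_trans _ _ (\sum_(J <- l) (expR (- (b *+ (r - #|C|))))%:E)%E).
  rewrite big_seq [leRHS]big_seq; apply: lee_sum => J.
  rewrite mem_filter => /andP[rJ _]; apply: le_trans (prob_AU J) _.
  by rewrite lee_fin ler_expR lerN2 ler_wpMn2l.
rewrite sumEFin lee_fin big_const_seq count_predT iter_addr_0 -[leLHS]mulr_natl.
rewrite ler_wpM2r ?expR_ge0// ler_nat size_filter.
apply: leq_trans (count_size _ _) _.
by rewrite -cardE -cardsT -powersetT card_powerset cardsT card_ord.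
Qed.
End WrongDecision.

Section StoppingTime.
Variables (lam c : R).
Hypotheses (lam0 : 0 < lam) (c0 : 0 < c).
Hypothesis expg : (\int[pi]_y (expR (lam * g y))%:E <= (expR (- (lam * c)))%:E)%E.
Hypothesis rC : (r <= s - #|C|)%N.
(** As before, [g] is the increment towards the wrong decision; [h] is the one towards the right
    decision. *)
Let h y := - g y.
Let rho := expR (- (lam * c)).

Section FixedThreshold.
Variable b : R.
Hypothesis b0 : 0 < b.
(** The least integer above [b / c]: by then the decay [rho ^+ n0] outweighs [expR (lam * b)]. *)
Let n0 := (Num.truncn (b / c)).+1.
(** Chernoff's majorant: the term of [i] is at least 1 whenever its true sum of [h] is still below
    [b] at time [n0 + m]. *)
Let q m w : R :=
  \sum_(i < s) expR (lam * b + lam * \sum_(k < n0 + m) g (x k i w)).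

Let mS n i : measurable_fun setT (fun w => \sum_(k < n) g (x k i w)).
Proof.
apply: (@measurable_psum _ _ _ (fun k w => g (x k i w))) => k _.
exact: measurableT_comp.
Qed.

Let q_ge0 m w : 0 <= q m w.
Proof. by apply: sumr_ge0 => i _; exact: expR_ge0. Qed.

Let mq m : measurable_fun setT (q m).
Proof.
apply: measurable_sum => i; apply: measurable_fun_expR.
by apply: measurable_funD => //; exact: measurable_funM.
Qed.

(* Each step after time [n0] at which some honest sensor has not crossed [b]
   contributes at least 1 to the series. *)
Let q_dominates w : (tau_up_r h x' r b w <= n0%:R%:E + \sum_(m <oo) (q m w)%:E)%E.
Proof.
pose bad m := [exists i : 'I_s, (i \notin C) && ~~ (b <= llr_sum h x' i (n0 + m) w)].
have bad_q m : bad m -> 1 <= q m w.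
  move=> /existsP[i /andP[iC]]; rewrite -ltNge => lb.
  rewrite /q (bigD1 i)//= -[leLHS]addr0 lerD//; last first.
    by apply: sumr_ge0 => j _; exact: expR_ge0.
  rewrite -expR0 ler_expR -mulrDr mulr_ge0 ?(ltW lam0)//.
  have -> : \sum_(k < n0 + m) g (x k i w) = - llr_sum h x' i (n0 + m) w.
    by rewrite -sumrN; apply: eq_bigr => k _; rewrite /h opprK honest.
  by rewrite subr_ge0 ltW.
have bad_sum m : (forall m', (m' < m)%N -> bad m') ->
    (m%:R%:E <= \sum_(m <oo) (q m w)%:E)%E.
  move=> hb; apply: le_trans (nneseries_lim_ge (m := 0) m _); last first.
    by move=> n _ _; rewrite lee_fin.
  rewrite big_mkord sumEFin lee_fin.
  have -> : m%:R = \sum_(i < m) (1 : R) by rewrite sumr_const card_ord.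
  by apply: ler_sum => i _; apply: bad_q; exact: hb.
have [ex|nex] := pselect (exists m, ~~ bad m).
  (* At the first good [m] all honest sensors, at least [r] of them, have crossed by time [n0 + m],
     and the [m] earlier bad indices are paid for by the series. *)
  case: (ex_minnP ex) => m good mmin.
  apply: (@le_trans _ _ (n0%:R%:E + m%:R%:E)%E); last first.
    rewrite leeD2l//; apply: bad_sum => m' m'm; apply: contraT => /mmin.
    by rewrite leqNgt m'm.
  rewrite -EFinD -natrD; apply: (@order_stat_le _ _ _ _ _ (~: C)) => //.
    by rewrite cardsCs finset.setCK card_ord.
  move=> i; rewrite inE => iC; apply: first_time_le => //.
  by move: good; rewrite negb_exists => /forallP/(_ i); rewrite iC/= negbK.
(* If every index is bad, the series diverges and the bound is trivial. *)
suff -> : (\sum_(m <oo) (q m w)%:E = +oo)%E by rewrite addey// leey.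
apply/eqyP => a a0; apply: (@le_trans _ _ ((Num.truncn a).+1)%:R%:E).
  by rewrite lee_fin ltW// truncnS_gt.
by apply: bad_sum => m _; apply: contrapT => /negP nb; apply: nex; exists m.
Qed.

Let integral_q m : (\int[P]_w (q m w)%:E <= (s%:R * rho ^+ m)%:E)%E.
Proof.
under eq_integral do rewrite /q -sumEFin.
rewrite ge0_integral_sum//; last first.
  move=> i; apply/measurable_EFinP; apply: measurable_fun_expR.
  by apply: measurable_funD => //; exact: measurable_funM.
apply: (@le_trans _ _ (\sum_(i < s) (rho ^+ m)%:E)%E); last first.
  by rewrite sumEFin lee_fin sumr_const card_ord mulr_natl.
apply: lee_sum => i _; under eq_integral do rewrite expRD EFinM.
rewrite ge0_integralZl//; last first.
  by apply/measurable_EFinP; apply: measurable_fun_expR; exact: measurable_funM.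
have H := integral_expR_psum mx mU indX lawX mg i (n0 + m) (expR_ge0 _) expg.
apply: (@le_trans _ _ ((expR (lam * b))%:E * (rho ^+ (n0 + m))%:E)%E).
  by apply: lee_wpmul2l => //; rewrite lee_fin expR_ge0.
rewrite -EFinM lee_fin exprD mulrA -[leRHS]mul1r ler_wpM2r ?exprn_ge0 ?expR_ge0//.
rewrite /rho -expRM_natl -expRD expR_le1.
have : b <= n0%:R * c by rewrite -ler_pdivrMr// ltW// truncnS_gt.
rewrite -subr_ge0 => /(mulr_ge0 (ltW lam0)); lra.
Qed.

(** Here [n0 <= b / c + 1] and the expected series is dominated by a geometric one, so the overhead
    beyond [b / c] does not depend on [b]. *)
Lemma integral_tau_up_r :
  (\int[P]_w tau_up_r h x' r b w <= (b / c + (1 + s%:R / (1 - rho)))%:E)%E.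
Proof.
have rho1 : rho < 1 by rewrite expR_lt1 oppr_lt0 mulr_gt0.
have rho_ge0 : 0 <= rho by exact: expR_ge0.
have mh : measurable_fun setT h by exact: measurableT_comp.
apply: (@le_trans _ _ (\int[P]_w (n0%:R%:E + \sum_(m <oo) (q m w)%:E))%E).
  apply: ge0_le_integral => //.
  - by move=> w _; apply: le_trans (tau_up_r_ge1 _ _ _ rs w).
  - exact: measurable_tau_up_r.
  - apply: emeasurable_funD => //; apply: ge0_emeasurable_sum => //.
      by move=> k w _ _; rewrite lee_fin.
    by move=> k _; exact/measurable_EFinP.
rewrite ge0_integralD//; last 2 first.
- by move=> w _; apply: nneseries_ge0 => k _ _; rewrite lee_fin.
- apply: ge0_emeasurable_sum => //.
    by move=> k w _ _; rewrite lee_fin.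
  by move=> k _; exact/measurable_EFinP.
rewrite integral_cst//= probability_setT mule1 integral_nneseries//; last 2 first.
- by move=> k; exact/measurable_EFinP.
- by move=> k w _; rewrite lee_fin.
rewrite addrA EFinD; apply: leeD.
  by rewrite lee_fin /n0 -natr1 lerD2r truncn_le divr_ge0 ?ltW.
apply: lime_le.
  by apply: is_cvg_nneseries => k _ _; apply: integral_ge0 => w _; rewrite lee_fin.
apply: nearW => n; apply: (@le_trans _ _ (\sum_(0 <= k < n) (s%:R * rho ^+ k)%:E)%E).
  by apply: lee_sum => k _; exact: integral_q.
rewrite sumEFin lee_fin -mulr_sumr ler_wpM2l// -[leRHS]mul1r ler_pdivlMr ?subr_gt0//.
rewrite big_mkord mulrC -opprB mulNr -subrX1 opprB.
by rewrite gerBl exprn_ge0.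
Qed.
End FixedThreshold.
End StoppingTime.
End OneSidedBounds.

(** * Both decisions and the stopping time, reduced to upward crossings *)

Section Symmetry.
Context {R : realType} {d : measure_display} {Omega : measurableType d} {s : nat}.
Variables (ell : R -> R) (y : nat -> 'I_s -> Omega -> R) (r : nat) (b : R).

(** Lets bounds proved for upward crossings serve both decisions. *)
Lemma tau_dn_rE : tau_dn_r ell y r b = tau_up_r (fun z => - ell z) y r b.
Proof.
apply/funext => w; congr (order_stat r _); apply/funext => i.
rewrite /tau_dn /tau_up; congr first_time; apply/funext => n; apply/propext.
have -> : llr_sum (fun z => - ell z) y i n w = - llr_sum ell y i n w.
  by rewrite /llr_sum sumrN.
by rewrite lerNr.
Qed.

(** Matches [integral_tau_up_r], which concludes about [- g], when [g] is [- ell]. *)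
Lemma tau_up_rE : tau_up_r ell y r b = tau_up_r (fun z => - - ell z) y r b.
Proof.
by congr (tau_up_r _ y r b); apply/funext => z; rewrite opprK.
Qed.

Hypotheses (mell : measurable_fun setT ell)
  (my : forall k i, measurable_fun setT (y k i)) (rs : (0 < r <= s)%N).

Let mup : measurable_fun setT (tau_up_r ell y r b).
Proof. exact: measurable_tau_up_r. Qed.

Let mdn : measurable_fun setT (tau_dn_r ell y r b).
Proof.
rewrite tau_dn_rE; apply: measurable_tau_up_r => //; exact: measurableT_comp.
Qed.

Let measurable_tie (t t' : Omega -> \bar R) :
  measurable_fun setT t -> measurable_fun setT t' ->
  measurable [set w | t w = t' w /\ (t w < +oo)%E].
Proof.
move=> mt mt'; rewrite (_ : [set w | _] =
    [set w | t w = t' w] `&` [set w | (t w < +oo)%E])//.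
by apply: measurableI; rewrite -[X in measurable X]setTI;
  [exact: measurable_eqe|exact: emeasurable_fun_infty_o].
Qed.

(** Winning strictly and tying at a finite time are disjoint, and both force [t] to be finite. [tie]
    is a parameter because both decisions write the tie through [tau_up_r]. *)
Let decision_le (P : probability Omega R) (t t' : Omega -> \bar R)
  (tie : set Omega) : measurable_fun setT t -> measurable_fun setT t' ->
  tie = [set w | t w = t' w /\ (t w < +oo)%E] ->
  (P [set w | t w < t' w] + 2^-1%:E * P tie <= P [set w | t w < +oo])%E.
Proof.
move=> mt mt' tieE.
have mlt : measurable [set w | (t w < t' w)%E].
  by rewrite -[X in measurable X]setTI; exact: measurable_lte.
have mtie : measurable tie by rewrite tieE; exact: measurable_tie.
apply: (@le_trans _ _ (P [set w | (t w < t' w)%E] + P tie)%E).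
  rewrite leeD2l// -[leRHS]mul1e lee_wpmul2r// lee_fin; lra.
rewrite -measureU//; last first.
  by rewrite tieE; apply/seteqP; split => // w /= [+ [tt' _]]; rewrite tt' ltxx.
apply: le_measure; rewrite ?inE//.
- exact: measurableU.
- by rewrite -[X in measurable X]setTI; exact: emeasurable_fun_infty_o.
- by rewrite tieE => w /= [tt'|[]//]; apply: lt_le_trans tt' (leey _).
Qed.

Lemma prob_decide1_le (P : probability Omega R) :
  (prob_decide1 ell y r b P <= P [set w | tau_up_r ell y r b w < +oo])%E.
Proof. exact: decision_le. Qed.

Lemma prob_decide0_le (P : probability Omega R) :
  (prob_decide0 ell y r b P <=
   P [set w | tau_up_r (fun z => (- ell z)%R) y r b w < +oo])%E.
Proof.
rewrite -tau_dn_rE; apply: decision_le => //.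
by apply/seteqP; split => w /= [->].
Qed.

Lemma prob_decide1_ge0 (P : probability Omega R) : (0 <= prob_decide1 ell y r b P)%E.
Proof. by rewrite adde_ge0// mule_ge0. Qed.

Lemma prob_decide0_ge0 (P : probability Omega R) : (0 <= prob_decide0 ell y r b P)%E.
Proof. by rewrite adde_ge0// mule_ge0. Qed.

Let mT : measurable_fun setT (vote_T ell y r b).
Proof. exact: measurable_mine. Qed.

Let T_ge1 w : (1 <= vote_T ell y r b w)%E.
Proof. by rewrite le_min tau_dn_rE !tau_up_r_ge1. Qed.

Let T_ge0 w : (0 <= vote_T ell y r b w)%E.
Proof. exact: le_trans (T_ge1 w). Qed.

Lemma integral_vote_T_ge1 (P : probability Omega R) :
  (1 <= \int[P]_w vote_T ell y r b w)%E.
Proof.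
rewrite -[leLHS](_ : \int[P]_w (cst 1%E w) = 1)%E.
  exact: ge0_le_integral.
by rewrite integral_cst//= probability_setT mule1.
Qed.

Lemma integral_vote_T_le_up (P : probability Omega R) :
  (\int[P]_w vote_T ell y r b w <= \int[P]_w tau_up_r ell y r b w)%E.
Proof. by apply: ge0_le_integral => // w _; rewrite ge_min lexx orbT. Qed.

Lemma integral_vote_T_le_dn (P : probability Omega R) :
  (\int[P]_w vote_T ell y r b w <= \int[P]_w tau_dn_r ell y r b w)%E.
Proof. by apply: ge0_le_integral => // w _; rewrite ge_min lexx. Qed.

End Symmetry.

(** * Assembling the error exponent *)

Lemma err_exponent_ge {R : realType} (p : \bar R) (L t : R) : 0 < L ->
  (0 <= p)%E -> (p <= (L * expR (- t))%:E)%E -> ((t - ln L)%:E <= err_exponent p)%E.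
Proof.
move=> L0 p0 pL; rewrite /err_exponent; case: eqP => [_|/eqP pn0]; first exact: leey.
have pfin : p \is a fin_num by rewrite ge0_fin_numE// (le_lt_trans pL) ?ltry.
rewrite -(fineK pfin) in p0 pn0 pL *; move: (fine p) p0 pn0 pL => q.
rewrite !lee_fin eqe /= => q0 qn0 qL.
have qgt0 : 0 < q by rewrite lt_def qn0.
have : ln q <= ln (L * expR (- t)) by rewrite ler_ln ?posrE ?mulr_gt0 ?expR_gt0.
rewrite lnM ?posrE ?expR_gt0// expRK; lra.
Qed.

(** [E] may be [+oo], when no error occurs, but [D] is finite and positive, so the ratio can be
    cleared. *)
Lemma ge_div_ereal {R : realType} (q B N : R) (E D : \bar R) : 0 <= q ->
  (1 <= D)%E -> (D <= B%:E)%E -> (N%:E <= E)%E -> q * B <= N -> (q%:E <= E / D)%E.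
Proof.
move=> q0 D1 DB NE qBN.
have Dfin : D \is a fin_num.
  by rewrite ge0_fin_numE ?(le_trans _ D1)// (le_lt_trans DB) ?ltry.
rewrite -(fineK Dfin) in D1 DB *; move: (fine D) D1 DB => D'.
rewrite !lee_fin => D1 DB; have D0 : 0 < D' by exact: lt_le_trans D1.
rewrite inver gt_eqF// lee_pdivlMr//.
apply: le_trans NE; rewrite -EFinM lee_fin; apply: le_trans qBN.
by rewrite ler_wpM2l.
Qed.

(** The density cancels the integrand, leaving the total mass of [nu]. *)
Lemma integral_expRN_density {R : realType} (mu nu : probability R R) (ell : R -> R) :
  measurable_fun setT ell ->
  (forall B, measurable B -> (mu B = \int[nu]_(y in B) (expR (ell y))%:E)%E) ->
  (\int[mu]_y (expR (- ell y))%:E = 1)%E.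
Proof.
move=> mell muE.
rewrite (@ge0_integral_density _ _ _ mu nu (fun y => expR (ell y))).
- rewrite -[RHS](@probability_setT _ _ _ nu) -[RHS]mul1e -integral_cst//.
  by apply: eq_integral => y _; rewrite -EFinM -expRD addNr expR0.
- exact: measurable_fun_expR.
- by move=> y; exact: expR_ge0.
- exact: muE.
- by apply/measurable_EFinP; apply: measurable_fun_expR; exact: measurableT_comp.
- by move=> y; rewrite lee_fin expR_ge0.
Qed.

(** The limit is read as a lower bound up to any [eps] for all large thresholds, the smaller
    exponent standing for the common error. Earlier injections being functions of [U] and of
    compromised observations, the recursive attack unfolds into measurability with respect to
    these. *)
Theorem theorem5 (R : realType) (s cbar : nat)
  (mu nu : probability R R) (ell : R -> R)
  (d : measure_display) (Omega : measurableType d)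
  (P : bool -> probability Omega R)
  (x : nat -> 'I_s -> Omega -> R) (U : Omega -> R)
  (C : {set 'I_s}) (xa : bool -> nat -> 'I_s -> Omega -> R) :
  (* mu, nu mutually absolutely continuous, ell = log (d mu / d nu) *)
  measurable_fun setT ell ->
  (forall B, measurable B -> (mu B = \int[nu]_(y in B) (expR (ell y))%:E)%E) ->
  (* 0 < I_0, I_1 < oo *)
  mu.-integrable setT (EFin \o ell) -> nu.-integrable setT (EFin \o ell) ->
  (0 < \int[mu]_y (ell y)%:E)%E -> (0 < - \int[nu]_y (ell y)%:E)%E ->
  (* true observations: independent, law nu under theta = 0, mu under 1;
     U = attacker's randomization, independent of the observations *)
  (forall k i, measurable_fun setT (x k i)) -> measurable_fun setT U ->
  (forall th k i B, measurable B ->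
     P th (x k i @^-1` B) = (if th then mu else nu) B) ->
  (forall th, mutually_independent (P th)
     (fun o : option (nat * 'I_s) =>
        match o with None => U | Some p => x p.1 p.2 end)) ->
  (* bounds on the number of compromised sensors *)
  (#|C| <= cbar)%N -> (2 * cbar < s)%N ->
  (* admissible attack: supported on C, causal in the compromised sensors *)
  (forall th k i w, i \notin C -> xa th k i w = 0) ->
  (forall th k i B, measurable B ->
     <<s [set A | (exists B', measurable B' /\ A = U @^-1` B') \/
                  (exists j i' B', i' \in C /\ (j <= k)%N /\ measurable B' /\
                                   A = x j i' @^-1` B')] >>
       (xa th k i @^-1` B)) ->
  let I := (Order.min (- \int[nu]_y (ell y)%:E) (\int[mu]_y (ell y)%:E))%E in
  let x' th := fun k i w => x k i w + xa th k i w in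
  let r := (s - cbar)%N in
  let alpha b := prob_decide1 ell (x' false) r b (P false) in
  let beta b := prob_decide0 ell (x' true) r b (P true) in
  let D b := (Order.max (\int[P false]_w vote_T ell (x' false) r b w)
                        (\int[P true]_w vote_T ell (x' true) r b w))%E in
  forall eps : R, 0 < eps ->
  \forall b \near +oo,
    (((s - cbar - #|C|)%:R)%:E * I - eps%:E <=
     Order.min (err_exponent (alpha b)) (err_exponent (beta b)) / D b)%E.
Proof.
move=> mell muE imu inu I1pos I0pos mx mU law indep Cc cs xa0 xaS I x' r alpha beta D
  eps eps0.
have mx' th k i : measurable_fun setT (x' th k i).
  apply: measurable_funD => // _ B mB; rewrite setTI.
  apply: (smallest_sub (@sigma_algebra_measurable _ Omega)) (xaS th k i B mB).
  move=> _ [[B' [mB' ->]]|[j [i' [B' [_ [_ [mB' ->]]]]]]];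
    rewrite -[X in measurable X]setTI; [exact: mU|exact: mx].
have honest th k i w : i \notin C -> x' th k i w = x k i w.
  by move=> iC; rewrite /x' xa0// addr0.
have rs : (0 < r <= s)%N by rewrite /r; lia.
have rC : (r <= s - #|C|)%N by rewrite /r; lia.
set m := (s - cbar - #|C|)%N.
have m0 : (0 < m)%N by rewrite /m; lia.
have mN : measurable_fun setT (fun y => - ell y) by exact: measurableT_comp.
have e0 : (\int[nu]_y (expR (ell y))%:E <= 1)%E.
  by rewrite -muE// probability_setT.
have e1 : (\int[mu]_y (expR (- ell y))%:E <= 1)%E.
  by rewrite (integral_expRN_density mell muE).
have imuN : mu.-integrable setT (EFin \o (fun y => - ell y)).
  rewrite (_ : EFin \o _ = (-%E \o (EFin \o ell))); first exact: integrableN.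
  by apply/funext => y.
have [i i0 IE] : exists2 i : R, 0 < i & I = i%:E.
  have Ifin : I \is a fin_num.
    rewrite /I; case: (leP _ _) => _; last exact: integrable_fin_num.
    by rewrite fin_numN; exact: integrable_fin_num.
  exists (fine I); last by rewrite fineK.
  by rewrite -lte_fin fineK// /I lt_min I1pos I0pos.
pose mR : R := m%:R; have mR0 : 0 < mR by rewrite ltr0n.
(* The first branch keeps [c] positive; the second makes [mR * c] at least [mR * i - eps / 2]. *)
pose c := Order.max (i / 2) (i - eps / (2 * mR)).
have c0 : 0 < c by rewrite lt_max divr_gt0.
have epsm : 0 < eps / (2 * mR) by rewrite divr_gt0// mulr_gt0.
have ci : c < i by rewrite gt_max; apply/andP; split; lra.
have mc : mR * i - eps < mR * c.
  have h : i - eps / (2 * mR) <= c by rewrite le_max lexx orbT.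
  have := ler_wpM2l (ltW mR0) h.
  have -> : mR * (i - eps / (2 * mR)) = mR * i - eps / 2 by field; rewrite gt_eqF.
  lra.
have mean0 : (\int[nu]_y (ell y)%:E < (- c)%:E)%E.
  rewrite EFinN lteNr; apply: lt_le_trans (_ : i%:E <= _)%E; first by rewrite lte_fin.
  by rewrite -IE /I ge_min lexx.
have mean1 : (\int[mu]_y (- ell y)%:E < (- c)%:E)%E.
  under eq_integral do rewrite -mulN1r EFinM.
  rewrite integralZl//= mulN1e EFinN lteN2; apply: lt_le_trans (_ : i%:E <= _)%E.
    by rewrite lte_fin.
  by rewrite -IE /I ge_min lexx orbT.
have [lam0 lam0pos E0] := exponential_moment inu e0 mean0.
have [lam1 lam1pos E1] := exponential_moment imuN e1 mean1.
pose rho lam := expR (- (lam * c)).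
have rho1 lam : 0 < lam -> 0 < 1 - rho lam.
  by move=> l0; rewrite subr_gt0 expR_lt1 oppr_lt0 mulr_gt0.
pose K lam := 1 + s%:R / (1 - rho lam).
have K0 lam : 0 < lam -> 0 <= K lam.
  by move=> l0; rewrite addr_ge0// divr_ge0// ltW// rho1.
pose K2 := K lam0 + K lam1.
pose L : R := (2 ^ s)%:R; have L0 : 0 < L by rewrite ltr0n expn_gt0.
(* The target ratio, cut off at 0 because [ge_div_ereal] requires a nonnegative one. *)
pose q := Order.max (mR * i - eps) 0.
have q0 : 0 <= q by rewrite le_max lexx orbT.
have qc : q / c < mR.
  by rewrite ltr_pdivrMr// gt_max mc mulr_gt0.
near=> b.
have b0 : 0 < b by near: b; exact: nbhs_pinfty_gt.
have D1 : (1 <= D b)%E.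
  by rewrite le_max integral_vote_T_ge1.
have DB : (D b <= (b / c + K2)%:E)%E.
  rewrite ge_max; apply/andP; split.
    apply: le_trans (integral_vote_T_le_dn _ _ _ _ _) _ => //.
    rewrite tau_dn_rE.
    apply: le_trans (integral_tau_up_r mx (mx' false) mU (indep false)
      (law false) mell (honest false) rs lam0pos c0 E0 rC b0) _.
    by rewrite lee_fin lerD2l -[leLHS]addr0 lerD2l K0.
  apply: le_trans (integral_vote_T_le_up _ _ _ _ _) _ => //.
  rewrite tau_up_rE.
  apply: le_trans (integral_tau_up_r mx (mx' true) mU (indep true)
    (law true) mN (honest true) rs lam1pos c0 E1 rC b0) _.
  by rewrite lee_fin lerD2l -[leLHS]add0r lerD2r K0.
have aE : ((mR * b - ln L)%:E <=
    Order.min (err_exponent (alpha b)) (err_exponent (beta b)))%E.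
  rewrite le_min mulrC mulr_natr; apply/andP; split; apply: err_exponent_ge => //.
  - exact: prob_decide1_ge0.
  - apply: le_trans (prob_decide1_le _ _ _ _ _) _ => //.
    exact: (prob_tau_up_r_lty mx (mx' false) mU (indep false)
      (law false) mell (honest false) rs e0 (ltW b0)).
  - exact: prob_decide0_ge0.
  - apply: le_trans (prob_decide0_le _ _ _ _ _) _ => //.
    exact: (prob_tau_up_r_lty mx (mx' true) mU (indep true)
      (law true) mN (honest true) rs e1 (ltW b0)).
have qB : q * (b / c + K2) <= mR * b - ln L.
  (* The threshold solves the desired linear inequality for [b]; the slope [mR - q / c] is positive
     by [qc]. *)
  have hb : (ln L + q * K2) / (mR - q / c) <= b.
    by near: b; apply: nbhs_pinfty_ge; exact: num_real.
  move: hb; rewrite ler_pdivrMr ?subr_gt0//.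
  have -> : q * (b / c + K2) = b * (q / c) + q * K2 by ring.
  lra.
apply: (@le_trans _ _ q%:E).
  by rewrite IE -EFinM -EFinB lee_fin le_max lexx.
exact: ge_div_ereal D1 DB aE qB.
Unshelve. all: by end_near. Qed.
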